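(* Let $m$ be an integer and let $G=G[X,Y]$ be a finite bipartite graph (multiple edges allowed) with bipartition $\{X,Y\}$ in which the multiplicity of each edge is at least $m$. Let $f,g$ be integer-valued functions on $X\cup Y$ such that $0\le g(v)\le f(v)$ for every $v\in X\cup Y$, and such that $f(y)\le m$ and $g(y)=0$ for every $y\in Y$. Then $G$ has a $(g,f)$-factor if and only if $$\sum_{y\in N_G(S)} f(y)\;\ge\;\sum_{x\in S} g(x)\qquad\text{for all } S\subseteq X.$$
   Context: Graphs are finite and may have multiple (parallel) edges. The multiplicity of an edge joining $x$ and $y$ is the number of edges joining $x$ and $y$; so the hypothesis means that any two adjacent vertices are joined by at least $m$ edges. For a graph $G$ and a vertex $u$, $\deg_G(u)$ is the number of edges of $G$ incident with $u$, counted with multiplicity. For a set $S$ of vertices, $N_G(S)$ is the neighborhood of $S$ in $G$; for $S\subseteq X$ it is the set of vertices of $Y$ adjacent to at least one vertex of $S$. A $(g,f)$-factor of $G$ is a spanning subgraph $F$ of $G$ (same vertex set, edge set a subset of the edges of $G$, parallel edges being regarded as distinct) such that $g(v)\le \deg_F(v)\le f(v)$ for every vertex $v$. *)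

(* Defs.v *)
From mathcomp Require Import all_boot all_order all_algebra.

Set Implicit Arguments.
Unset Strict Implicit.
Unset Printing Implicit Defensive.

Import Order.TTheory GRing.Theory Num.Theory.

Local Open Scope ring_scope.

(* Edges form a type of their own, so that parallel edges are distinct edges
   with the same set of ends; there are no loops. *)
Record multigraph : Type := Multigraph {
  vertex :> finType;
  edge : finType;
  ends : edge -> {set vertex};
  card_ends : forall e : edge, #|ends e| = 2%N
}.

Arguments ends {G} e : rename.

Section Multigraph.

Variable G : multigraph.

Definition multiplicity (x y : G) : nat :=
  #|[set e : edge G | ends e == [set x; y]]|.

Definition adjacent : rel G :=
  fun x y => [exists e : edge G, ends e == [set x; y]].

Definition neighborhood (S : {set G}) : {set G} :=
  [set v | [exists u in S, adjacent u v]].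

(* The spanning subgraphs of [G] are identified with their edge sets
   [F : {set edge G}]. *)
Definition deg (F : {set edge G}) (u : G) : nat :=
  #|[set e in F | u \in ends e]|.

(* Either side of a bipartition may be empty. *)
Definition bipartition (X Y : {set G}) : Prop :=
  [/\ X :|: Y = [set: G], [disjoint X & Y] &
      forall e : edge G, exists x y : G,
        [/\ x \in X, y \in Y & ends e = [set x; y]]].

Definition is_gf_factor (g f : G -> int) (F : {set edge G}) : Prop :=
  forall v : G, g v <= (deg F v)%:Z <= f v.

End Multigraph.

(* Main.v *)
Require Import Defs.
From mathcomp Require Import all_boot all_order all_algebra.
From mathcomp Require Import zify.

(** The lower bound on multiplicities turns the factor problem into a
    transportation problem. Lower bounds are imposed on [X] only, so it is enough
    to find a factor [F] with degree exactly [g x] at each [x] in [X] and at most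
    [f y] at each [y] in [Y]. Such an [F] is known, up to the choice among parallel
    edges, from the number [t x y] of its edges between [x] and [y]: the row sums
    of [t] are the demands [g x], its column sums respect the capacities [f y].
    Conversely every such matrix [t] supported on adjacent pairs comes from a set
    of edges, since [t x y <= f y <= m] and adjacent vertices are joined by at
    least [m] edges ([realize_transport]). The existence of [t] under the stated
    inequality is the version of Hall's theorem with demands and capacities,
    [transport_of_hall].

    Necessity is double counting: the edges of a factor at [S] all end in the
    neighborhood of [S] ([leq_deg_neighborhood]).

    Hall's theorem is obtained by shipping one unit at a time. Call a set tight if
    Hall's inequality is an equality for it. Shipping a unit from [b0] to [a0] is
    harmful only if some tight set avoids [a0] but sees [b0]; as tight sets are
    closed under union ([tightU]), not every choice of [b0] can be harmful
    ([exists_unblocked]). *)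

Import Order.TTheory GRing.Theory Num.Theory.

Local Open Scope ring_scope.

(** * Transportation from capacities to demands *)

Section Transport.

Set Implicit Arguments.
Unset Strict Implicit.

Local Open Scope nat_scope.

Variables (A B : finType) (r : A -> B -> bool).

Implicit Types (S T : {set A}) (g : A -> nat) (f : B -> nat).

Definition image_set S : {set B} := [set b | [exists a in S, r a b]].

Lemma image_setU S T : image_set (S :|: T) = image_set S :|: image_set T.
Proof.
apply/setP=> b; rewrite !inE; apply/exists_inP/orP.
  by case=> a; rewrite inE => /orP[] aS rab; [left|right];
    apply/exists_inP; exists a.
by case=> /exists_inP[a aS rab]; exists a; rewrite // inE aS ?orbT.
Qed.

Lemma image_setI S T :
  image_set (S :&: T) \subset image_set S :&: image_set T.
Proof.
apply/subsetP=> b; rewrite !inE => /exists_inP[a].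
by rewrite inE => /andP[aS aT] rab; apply/andP; split; apply/exists_inP; exists a.
Qed.

Lemma sum_setUI (I : finType) (P Q : {set I}) (h : I -> nat) :
  \sum_(i in P :|: Q) h i + \sum_(i in P :&: Q) h i =
  \sum_(i in P) h i + \sum_(i in Q) h i.
Proof.
rewrite (big_mkcond (mem (P :|: Q))) (big_mkcond (mem (P :&: Q))).
rewrite (big_mkcond (mem P)) (big_mkcond (mem Q)) -!big_split /=.
by apply: eq_bigr => i _; rewrite !inE; case: (i \in P); case: (i \in Q) =>
  /=; rewrite ?addn0 ?add0n.
Qed.

Lemma leq_sum_subset (I : finType) (P Q : {set I}) (h : I -> nat) :
  P \subset Q -> \sum_(i in P) h i <= \sum_(i in Q) h i.
Proof.
move=> /subsetP PQ; rewrite (big_mkcond (mem P)) (big_mkcond (mem Q)) /=.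
by apply: leq_sum => i _; case: ifP => // /PQ ->.
Qed.

Definition hall_condition g f :=
  forall S, \sum_(a in S) g a <= \sum_(b in image_set S) f b.

Definition tight g f S := \sum_(a in S) g a == \sum_(b in image_set S) f b.

(** The slack of Hall's inequality is a nonnegative submodular function of the
    set, so its zeros are closed under union. *)
Lemma tightU g f S T :
  hall_condition g f -> tight g f S -> tight g f T -> tight g f (S :|: T).
Proof.
move=> hall /eqP tS /eqP tT; rewrite /tight eqn_leq hall /= image_setU.
have gUI := sum_setUI S T g.
have fUI := sum_setUI (image_set S) (image_set T) f.
have hI := leq_trans (hall (S :&: T)) (leq_sum_subset f (image_setI S T)).
lia.
Qed.

(** Otherwise each neighbour [b] of [a0] with [0 < f b] lies in the image of a
    tight set avoiding [a0]; the union [T] of all tight sets avoiding [a0] is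
    tight, and adding [a0] to it raises the demand but not the capacity within
    reach. *)
Lemma exists_unblocked g f a0 :
    hall_condition g f -> 0 < g a0 ->
  exists b0, [/\ r a0 b0, 0 < f b0 &
    forall S, a0 \notin S -> b0 \in image_set S -> ~~ tight g f S].
Proof.
move=> hall ga0; pose avoiding S := (a0 \notin S) && tight g f S.
pose T := \bigcup_(S | avoiding S) S.
have /andP[a0T /eqP tT] : avoiding T.
  apply: (big_ind avoiding) => // [|S1 S2 /andP[a1 t1] /andP[a2 t2]].
    rewrite /avoiding in_set0 /tight big_set0 /= eq_sym sum_nat_eq0.
    apply/forall_inP=> b; rewrite inE => /exists_inP[a].
    by rewrite in_set0.
  by rewrite /avoiding inE negb_or a1 a2 tightU.
have [/existsP[b0 /and3P[rb fb ub]]|noB] := boolP [exists b0,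
    [&& r a0 b0, 0 < f b0 & b0 \notin image_set T]].
  exists b0; split=> // S aS bS; apply: contra ub => tS.
  move: bS; rewrite !inE => /exists_inP[a aS' rab].
  apply/exists_inP; exists a => //; apply/bigcupP; exists S => //.
  by rewrite /avoiding aS.
have := hall (a0 |: T); rewrite big_setU1 //= tT.
suff -> : \sum_(b in image_set (a0 |: T)) f b = \sum_(b in image_set T) f b.
  by lia.
rewrite image_setU (big_mkcond (mem (_ :|: _))) (big_mkcond (mem (image_set T))).
apply: eq_bigr => b _; rewrite /= in_setU.
case: (boolP (b \in image_set T)) => bT; rewrite ?orbT ?orbF //.
case: ifP => //; rewrite inE => /exists_inP[a /set1P-> rab].
move: noB; rewrite negb_exists => /forallP/(_ b).
by rewrite rab bT andbT /=; case: (f b).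
Qed.

Lemma sum_decr (I : finType) (h : I -> nat) (i0 : I) (P : {set I}) :
    0 < h i0 ->
  \sum_(i in P) (h i - (i == i0)) + (i0 \in P) = \sum_(i in P) h i.
Proof.
move=> h0; have -> : (i0 \in P : nat) = \sum_(i in P) (i == i0).
  case: (boolP (i0 \in P)) => iP; last first.
    rewrite big1 // => i iP'; apply/eqP; rewrite eqb0.
    by apply: contraNneq iP => <-.
  rewrite (bigD1 i0) //= eqxx big1 // => i /andP[_ /negPf-> //].
rewrite -big_split /=; apply: eq_bigr => i _.
by case: eqVneq => [->|_] /=; lia.
Qed.

(** Hall's marriage theorem with multiplicities, by induction on the total
    demand: one unit is shipped along a pair [(a0, b0)]. A set [S] loses slack
    only when [b0] is in its image and [a0] is not in [S], which is where
    [exists_unblocked] provides slack to lose. *)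
Theorem transport_of_hall g f :
    hall_condition g f ->
  exists t : A -> B -> nat,
    [/\ forall a b, 0 < t a b -> r a b,
        forall a, \sum_b t a b = g a &
        forall b, \sum_a t a b <= f b].
Proof.
have [n] := ubnP (\sum_a g a); elim: n => // n IHn in g f *.
move=> le_n hall.
have [/existsP[a0 ga0]|] := boolP [exists a, 0 < g a]; last first.
  rewrite negb_exists => /forallP g0; exists (fun _ _ => 0); split=> //.
    by move=> a; rewrite big1 //; have := g0 a; lia.
  by move=> b; rewrite big1.
have [b0 [rab fb0 unblocked]] := exists_unblocked hall ga0.
pose g' a := g a - (a == a0); pose f' b := f b - (b == b0).
have [| S | t [rt tg tf]] := IHn g' f'.
- have := sum_decr setT ga0; rewrite inE.
  rewrite !(eq_bigl _ _ (@in_setT A)) => eq_g; move: le_n; rewrite -eq_g.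
  by rewrite /g' addn1.
- have gS := sum_decr S ga0.
  have fS := sum_decr (image_set S) fb0.
  have := hall S; have := unblocked S; rewrite /tight /g' /f'.
  case: (boolP (a0 \in S)) gS => aS gS.
    suff bS : b0 \in image_set S by rewrite bS in fS *; lia.
    by rewrite inE; apply/exists_inP; exists a0.
  by case: (b0 \in image_set S) fS => fS; lia.
exists (fun a b => t a b + ((a == a0) && (b == b0))); split=> [a b|a|b].
- case: (boolP (_ && _)) => [/andP[/eqP-> /eqP->] //|_].
  by rewrite addn0; apply: rt.
- rewrite big_split /= tg /g'.
  have -> : \sum_b ((a == a0) && (b == b0)) = (a == a0).
    case: (a == a0); last by rewrite big1.
    by rewrite (bigD1 b0) //= eqxx big1 // => b /negPf->.
  by case: eqVneq => [->|_] /=; lia.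
- rewrite big_split /=.
  have -> : \sum_a ((a == a0) && (b == b0)) = (b == b0).
    rewrite (bigD1 a0) //= eqxx big1 ?addn0 // => a /negPf-> //.
  by have := tf b; rewrite /f'; case: eqVneq => [->|_] /=; lia.
Qed.

End Transport.

(** * Degrees and edge counts in a bipartite multigraph *)

Section Bipartite.

Set Implicit Arguments.
Unset Strict Implicit.

Variable G : multigraph.

Implicit Types (X Y : {set G}) (F : {set edge G}).

Definition edges_between F (x y : G) : {set edge G} :=
  [set e in F | ends e == [set x; y]].

Lemma bipartition_sym X Y : bipartition X Y -> bipartition Y X.
Proof.
case=> cover dis ends_XY; split; rewrite 1?setUC 1?disjoint_sym //.
by move=> e; have [x [y [xX yY Ee]]] := ends_XY e; exists y, x; rewrite setUC.
Qed.

Lemma ends_across X Y x (e : edge G) :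
    bipartition X Y -> x \in X -> x \in ends e ->
  exists2 y, y \in Y & ends e = [set x; y].
Proof.
case=> _ dis /(_ e)[x' [y [_ yY ->]]] xX /set2P[->|xy]; first by exists y.
by have := disjointFr dis xX; rewrite xy yY.
Qed.

Lemma ends_inj (e : edge G) x y z :
  ends e = [set x; y] -> ends e = [set x; z] -> y = z.
Proof.
move=> ey ez; have : y \in [set x; z] by rewrite -ez ey set22.
case/set2P=> // yx; have := card_ends e.
by rewrite ey yx setUid cards1.
Qed.

Lemma adjacent_across X Y x y :
  bipartition X Y -> x \in X -> adjacent x y -> y \in Y.
Proof.
move=> bip xX /existsP[e /eqP Ee].
have xe : x \in ends e by rewrite Ee set21.
have [z zY Ez] := ends_across bip xX xe.
by rewrite (@ends_inj e x y z).
Qed.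

Lemma edges_between_adjacent F x y :
  edges_between F x y != set0 -> adjacent x y.
Proof. by case/set0Pn=> e; rewrite inE => /andP[_ Ee]; apply/existsP; exists e. Qed.

Lemma deg_sum X Y F x :
    bipartition X Y -> x \in X ->
  deg F x = (\sum_(y in Y) #|edges_between F x y|)%N.
Proof.
move=> bip xX; rewrite /deg.
under eq_bigr => y _ do rewrite -sum1_card big_mkcond /=.
rewrite -sum1_card big_mkcond exchange_big /=; apply: eq_bigr => e _.
rewrite inE; have [eF|eF] := boolP (e \in F); last first.
  by rewrite big1 // => y _; rewrite inE (negPf eF).
rewrite /=; case: (boolP (x \in ends e)) => xe; last first.
  rewrite big1 // => y _; rewrite inE eF /= (_ : (_ == _) = false) //.
  by apply: contraNF xe => /eqP->; rewrite set21.
have [z zY Ez] := ends_across bip xX xe.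
rewrite (bigD1 z) //= inE eF Ez eqxx big1 // => y /andP[_ yz].
rewrite inE eF /=; case: eqP => // Ey.
by rewrite (@ends_inj e x y z) ?eqxx // in yz; rewrite Ez.
Qed.

Lemma edges_betweenC F x y : edges_between F x y = edges_between F y x.
Proof. by apply/setP=> e; rewrite !inE setUC. Qed.

(** Each edge of [F] at [S] is counted once on the left, as it has just one end
    in [X], and once on the right, at its other end. *)
Lemma leq_deg_neighborhood X Y F (S : {set G}) :
    bipartition X Y -> S \subset X ->
  (\sum_(x in S) deg F x <= \sum_(y in neighborhood S) deg F y)%N.
Proof.
move=> bip SX.
have NY : neighborhood S \subset Y.
  apply/subsetP=> y; rewrite inE => /exists_inP[x xS].
  exact: adjacent_across bip (subsetP SX x xS).
under eq_bigr => x xS do rewrite (deg_sum F bip (subsetP SX x xS)).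
under [leqRHS]eq_bigr => y yN
  do rewrite (deg_sum F (bipartition_sym bip) (subsetP NY y yN)).
rewrite exchange_big /= (big_setID (neighborhood S)) /=.
rewrite (setIidPr NY) [X in (_ + X)%N]big1 ?addn0 => [|y /setDP[_ yN]].
  apply: leq_sum => y _; under eq_bigr => x _ do rewrite edges_betweenC.
  exact: leq_sum_subset.
apply: big1 => x xS; apply/eqP; rewrite cards_eq0.
apply: contraNT yN => /edges_between_adjacent xy.
by rewrite inE; apply/exists_inP; exists x.
Qed.

Lemma card_subset_exists (T : finType) (D : {set T}) n :
  (n <= #|D|)%N -> exists2 E : {set T}, E \subset D & #|E| = n.
Proof.
move=> le_n; exists [set:: take n (enum D)].
  by apply/subsetP=> x; rewrite inE => /mem_take; rewrite mem_enum.
rewrite cardsE (card_uniqP _) ?take_uniq ?enum_uniq //.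
by rewrite size_take_min -cardE; apply/minn_idPl.
Qed.

(** Prescribing the number of chosen edges independently for each pair of
    classes of parallel edges meets no obstruction beyond the multiplicities. *)
Lemma realize_transport X Y (t : G -> G -> nat) :
    bipartition X Y ->
    (forall x y, x \in X -> y \in Y -> t x y <= multiplicity x y)%N ->
  exists F : {set edge G}, forall x y, x \in X -> y \in Y ->
    #|edges_between F x y| = t x y.
Proof.
move=> bip le_t.
pose par (x y : G) := [set e : edge G | ends e == [set x; y]].
have /fin_all_exists[c cP] (p : G * G) : exists E : {set edge G},
    (p.1 \in X) && (p.2 \in Y) -> E \subset par p.1 p.2 /\ #|E| = t p.1 p.2.
  case: (boolP (_ && _)) => [/andP[pX pY]|_]; last by exists set0.
  have [E sE cE] := card_subset_exists (le_t _ _ pX pY).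
  by exists E.
exists [set e | [exists x in X, [exists y in Y, e \in c (x, y)]]] => x y xX yY.
have [] := cP (x, y); rewrite /= ?xX ?yY // => sE <-; congr #|pred_of_set _|.
apply/setP=> e; rewrite !inE; apply/andP/idP => [[]|ec]; last first.
  have := subsetP sE e ec; rewrite inE => Ee; split=> //.
  by apply/exists_inP; exists x => //; apply/exists_inP; exists y.
case/exists_inP=> x' x'X /exists_inP[y' y'Y ec] /eqP Ee.
have [] := cP (x', y'); rewrite /= ?x'X ?y'Y // => /subsetP/(_ e ec).
rewrite inE Ee => /eqP E' _.
have dis : [disjoint X & Y] by case: bip.
have xx' : x = x'.
  have : x \in [set x'; y'] by rewrite -E' set21.
  by case/set2P=> // xy; have := disjointFr dis xX; rewrite xy y'Y.
by rewrite xx' (@ends_inj e x' y y') // Ee ?xx' // -E' xx'.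
Qed.

End Bipartite.

(** * Factors with lower bounds on one side *)

Theorem corollary1p4 (m : int) (G : multigraph) (X Y : {set G})
    (hXY : bipartition X Y)
    (hm : forall x y : G, adjacent x y -> m <= (multiplicity x y)%:Z)
    (f g : G -> int)
    (hgf : forall v : G, 0 <= g v <= f v)
    (hfY : forall y : G, y \in Y -> f y <= m)
    (hgY : forall y : G, y \in Y -> g y = 0) :
  (exists F : {set edge G}, is_gf_factor g f F) <->
  (forall S : {set G}, S \subset X ->
     \sum_(y in neighborhood S) f y >= \sum_(x in S) g x).
Proof.
have sumZ (I : finType) (P : {set I}) (h : I -> nat) :
    \sum_(i in P) (h i)%:Z = (\sum_(i in P) h i)%N%:Z.
  by rewrite (big_morph Posz PoszD (erefl _)).
split=> [[F factorF] S SX|hall].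
  apply: (@le_trans _ _ (\sum_(x in S) (deg F x)%:Z)).
    by apply: ler_sum => x _; case/andP: (factorF x).
  apply: (@le_trans _ _ (\sum_(y in neighborhood S) (deg F y)%:Z)).
    by rewrite !sumZ lez_nat (leq_deg_neighborhood F hXY SX).
  by apply: ler_sum => y _; case/andP: (factorF y).
(* Vertices outside [X] also index rows of the matrix; their demand is zero. *)
pose gn v := if v \in X then `|g v|%N else 0%N; pose fn v := `|f v|%N.
have gnE v : v \in X -> (gn v)%:Z = g v.
  by move=> vX; rewrite /gn vX gez0_abs //; case/andP: (hgf v).
have fnE v : (fn v)%:Z = f v.
  by rewrite gez0_abs //; case/andP: (hgf v) => g0; apply: le_trans.
pose r (x y : G) := (x \in X) && adjacent x y.
have hall_nat : hall_condition r gn fn.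
  move=> S; have -> : image_set r S = neighborhood (S :&: X).
    apply/setP=> y; rewrite !inE; apply: eq_existsb => x.
    by rewrite inE /r andbA.
  rewrite (big_setID X) /= [X in (_ + X)%N]big1 ?addn0 => [|x /setDP[_ xX]].
    rewrite -lez_nat -!sumZ.
    under eq_bigr => x /setIP[_ xX] do rewrite gnE //.
    under [leRHS]eq_bigr => y _ do rewrite fnE.
    by apply: hall; apply: subsetIr.
  by rewrite /gn (negPf xX).
have [t [tr tg tf]] := transport_of_hall hall_nat.
have t_le x y : (t x y <= fn y)%N.
  by apply: leq_trans (tf y); rewrite (bigD1 x) //= leq_addr.
have [|F tF] := realize_transport (t := t) hXY => [x y xX yY|].
  case: (posnP (t x y)) => [->//|/tr/andP[_ xy]].
  rewrite -lez_nat; apply: le_trans (hm _ _ xy).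
  by apply: le_trans (hfY _ yY); rewrite -fnE lez_nat.
exists F => v; have [XY dis _] := hXY.
have : v \in X :|: Y by rewrite XY inE.
case/setUP=> [vX|vY].
  suff -> : deg F v = gn v by rewrite gnE // lexx; case/andP: (hgf v).
  rewrite (deg_sum F hXY vX) -tg [RHS](bigID (mem Y)) /=.
  rewrite [X in (_ + X)%N]big1 ?addn0 => [|y yY].
    by apply: eq_bigr => y yY; apply: tF.
  apply/eqP; rewrite -leqn0 leqNgt; apply: contra yY => /tr/andP[_].
  exact: adjacent_across hXY vX.
rewrite hgY // lez_nat /= -fnE lez_nat.
rewrite (deg_sum F (bipartition_sym hXY) vY).
apply: leq_trans (tf v); rewrite [leqRHS](bigID (mem X)) /=.
apply: leq_trans (leq_addr _ _); apply: leq_sum => x xX.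
by rewrite edges_betweenC tF.
Qed.
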